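(* If $r$ is a positive even integer, then $$\begin{aligned}\int_0^\pi\frac{x^2\cos x}{L_r^2-4\cos^2(2x)}\,dx ={}& -\frac{\pi}{2L_r}\frac{\sqrt{\beta^r}}{1-\beta^r}\left(\mathrm{Li}_2\left(\sqrt{\beta^r}\right)-\mathrm{Li}_2\left(-\sqrt{\beta^r}\right)\right)\\ &-\frac{\pi}{2L_r}\frac{\sqrt{\beta^r}}{1+\beta^r}\left(\mathrm{Cl}_2\left(2\arctan\sqrt{\beta^r}\right)+\mathrm{Cl}_2\left(\pi-2\arctan\sqrt{\beta^r}\right)\right)\\ &-\frac{\pi}{L_r}\frac{\sqrt{\beta^r}}{1+\beta^r}\arctan\left(\sqrt{\beta^r}\right)\ln\left(\sqrt{\beta^r}\right)\end{aligned}$$ and $$\begin{aligned}\int_0^\pi\frac{x^2\cos(3x)}{L_r^2-4\cos^2(2x)}\,dx ={}& \left(\frac1{L_r}-1\right)\frac{\pi}{2}\frac{\sqrt{\beta^r}}{1-\beta^r}\left(\mathrm{Li}_2\left(\sqrt{\beta^r}\right)-\mathrm{Li}_2\left(-\sqrt{\beta^r}\right)\right)\\ &+\left(\frac1{L_r}+1\right)\frac{\pi}{2}\frac{\sqrt{\beta^r}}{1+\beta^r}\left(\mathrm{Cl}_2\left(2\arctan\sqrt{\beta^r}\right)+\mathrm{Cl}_2\left(\pi-2\arctan\sqrt{\beta^r}\right)\right)\\ &+\left(\frac1{L_r}+1\right)\frac{\pi\sqrt{\beta^r}}{1+\beta^r}\arctan\left(\sqrt{\beta^r}\right)\ln\l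eft(\sqrt{\beta^r}\right).\end{aligned}$$
   Context: $\beta=(1-\sqrt5)/2$ (so $0<\beta^r<1$ for $r$ positive and even, and $\sqrt{\beta^r}$ is the positive root). The Lucas numbers are $L_0=2$, $L_1=1$, $L_n=L_{n-1}+L_{n-2}$. The dilogarithm is $\mathrm{Li}_2(z)=\sum_{k=1}^\infty z^k/k^2$ for $|z|<1$. Clausen's function is $\mathrm{Cl}_2(y)=\sum_{n=1}^\infty \sin(ny)/n^2=-\int_0^y\ln|2\sin(\theta/2)|\,d\theta$. *)

(* Defs.v *)
From Stdlib Require Export Reals.
From Coquelicot Require Export Coquelicot.
Open Scope R_scope.

(* beta < 0, so sqrt (beta ^ r) is the genuine positive root only for even r. *)
Definition beta : R := (1 - sqrt 5) / 2.

Fixpoint lucas (n : nat) : nat :=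
  match n with
  | O => 2
  | S m => match m with
           | O => 1
           | S k => lucas m + lucas k
           end
  end%nat.

(* Coquelicot's [Series] starts at index 0, so the sums over n >= 1 below are
   shifted.  [Series] is total: [Li2 z] is the dilogarithm for |z| < 1. *)
Definition Li2 (z : R) : R := Series (fun k => z ^ S k / INR (S k) ^ 2).

Definition Cl2 (y : R) : R :=
  Series (fun n => sin (INR (S n) * y) / INR (S n) ^ 2).

(* Main.v *)
(** Put s = sqrt (beta^r), p = s^2; since r is even, L_r = p + 1/p, and partial
    fractions in cos 2x reduce both integrals to those of
    x^2 cos x / (1 - 2 q cos 2x + q^2) with q = p and q = -p.  This kernel equals
    1/(1-q) sum_k q^k cos((2k+1)x) up to an explicit remainder O(q^N), and
    int_0^pi x^2 cos((2k+1)x) dx = -2 pi/(2k+1)^2.  For q = p the resulting series is a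
    difference of two dilogarithms; for q = -p it is the inverse tangent integral
    Ti_2(s) = sum_k (-1)^k s^(2k+1)/(2k+1)^2.

    With s = tan t the latter satisfies
    Ti_2(tan t) = sum_k sin((2k+1)2t)/(2k+1)^2 + t ln(tan t).  The N-th partial sums of the
    two sides agree at t = pi/4, and the derivative of their difference is O(1/N)
    uniformly on every [a, pi/4] with a > 0. *)

Require Import Defs.
From Stdlib Require Import Reals Lra Lia.
From Coquelicot Require Import Coquelicot.
Open Scope R_scope.

(** * Odd-index parts of dilogarithm and Clausen series *)

(** The partial sums of the thinned series are the partial sums of [a] at indices [2 * n], a
    subsequence. Since [Li2] and [Cl2] are shifted by one, index [2 * k] carries their term of odd
    order [2k+1]. *)
Lemma is_series_even_terms (a : nat -> R) (l : R) :
  (forall k, a (2 * k + 1)%nat = 0) -> is_series a l ->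
  is_series (fun k => a (2 * k)%nat) l.
Proof.
  intros Hodd Ha.
  change (is_lim_seq (sum_n a) l) in Ha.
  change (is_lim_seq (sum_n (fun k => a (2 * k)%nat)) l).
  apply (is_lim_seq_subseq _ _ (fun n => 2 * n)%nat) in Ha.
  2:{ apply eventually_subseq; intros n; lia. }
  apply is_lim_seq_ext with (2 := Ha).
  induction n as [|n IH]; [now rewrite !sum_O|].
  rewrite (sum_Sn (fun k => a (2 * k)%nat)), <- IH.
  replace (2 * S n)%nat with (S (S (2 * n))) by lia.
  rewrite !sum_Sn.
  pose proof (Hodd n) as H0; replace (2 * n + 1)%nat with (S (2 * n)) in H0 by lia.
  rewrite H0.
  change (sum_n a (2 * n) + 0 + a (S (S (2 * n))) = sum_n a (2 * n) + a (S (S (2 * n)))).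
  ring.
Qed.

(** Telescoping: 1/(n+2)^2 <= 1/(n+1) - 1/(n+2). *)
Lemma sum_n_inv_sq_bound (n : nat) :
  sum_n (fun k => / INR (S k) ^ 2) n <= 2 - / INR (S n).
Proof.
  induction n as [|n IH].
  - rewrite sum_O; simpl; lra.
  - rewrite sum_Sn; pose proof (pos_INR n).
    rewrite !S_INR in *.
    assert (/ (INR n + 1 + 1) ^ 2 <= / (INR n + 1) - / (INR n + 1 + 1)).
    { apply Rminus_le_0.
      replace (/ (INR n + 1) - / (INR n + 1 + 1) - / (INR n + 1 + 1) ^ 2)
        with (/ ((INR n + 1) * (INR n + 1 + 1) ^ 2)) by (field; lra).
      left; apply Rinv_0_lt_compat, Rmult_lt_0_compat; nra. }
    change (sum_n (fun k => / INR (S k) ^ 2) n + / (INR n + 1 + 1) ^ 2 <= 2 - / (INR n + 1 + 1)).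
    lra.
Qed.

Lemma ex_series_inv_sq : ex_series (fun k => / INR (S k) ^ 2).
Proof.
  destruct (ex_finite_lim_seq_incr (sum_n (fun k => / INR (S k) ^ 2)) 2) as [l Hl].
  - intros n; rewrite sum_Sn; unfold plus; simpl.
    assert (0 < / INR (S (S n)) ^ 2).
    { apply Rinv_0_lt_compat, pow_lt, lt_0_INR; lia. }
    simpl in H; lra.
  - intros n; pose proof (sum_n_inv_sq_bound n).
    assert (0 < / INR (S n)) by (apply Rinv_0_lt_compat, lt_0_INR; lia). lra.
  - now exists l.
Qed.

(** [Series] is total, so convergence must be established before its value means anything; this one
    comparison serves both [Li2] (with powers of z) and [Cl2] (with sines). *)
Lemma ex_series_bounded_div_sq (u : nat -> R) :
  (forall k, Rabs (u k) <= 1) -> ex_series (fun k => u k / INR (S k) ^ 2).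
Proof.
  intros Hu.
  apply (ex_series_le (V := R_CompleteNormedModule)) with (b := fun k => / INR (S k) ^ 2).
  2: apply ex_series_inv_sq.
  intros k. change norm with Rabs.
  assert (0 < / INR (S k) ^ 2) by (apply Rinv_0_lt_compat, pow_lt, lt_0_INR; lia).
  unfold Rdiv; rewrite Rabs_mult, (Rabs_right (/ _)) by lra.
  specialize (Hu k). nra.
Qed.

Lemma pow_abs_le_1 (z : R) (n : nat) : Rabs z <= 1 -> Rabs (z ^ n) <= 1.
Proof.
  intros Hz. rewrite <- RPow_abs, <- (pow1 n).
  apply pow_incr; split; [apply Rabs_pos | exact Hz].
Qed.

Lemma INR_odd (k : nat) : INR (S (2 * k)) = 2 * INR k + 1.
Proof. rewrite S_INR, mult_INR; simpl; ring. Qed.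

(** Even powers cancel between [Li2 s] and [Li2 (- s)], odd ones double. *)
Lemma Li2_sub_opp (s : R) : Rabs s <= 1 ->
  is_series (fun k => s ^ (2 * k + 1) / (2 * INR k + 1) ^ 2)
    ((Li2 s - Li2 (- s)) / 2).
Proof.
  intros Hs.
  assert (H : forall z, Rabs z <= 1 ->
    is_series (fun k => z ^ S k / INR (S k) ^ 2) (Li2 z)).
  { intros z Hz; apply Series_correct, (ex_series_bounded_div_sq (fun k => z ^ S k)).
    intros k; now apply pow_abs_le_1. }
  pose proof (is_series_minus _ _ _ _ (H s Hs) (H (- s) ltac:(now rewrite Rabs_Ropp))) as Hd.
  apply (is_series_scal (/ 2)) in Hd.
  apply is_series_even_terms in Hd.
  - replace ((Li2 s - Li2 (- s)) / 2) with (scal (/ 2) (minus (Li2 s) (Li2 (- s)))).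
    + apply is_series_ext with (2 := Hd); intros k; cbv beta.
      rewrite INR_odd.
      replace (2 * k + 1)%nat with (S (2 * k)) by lia.
      change (/ 2 * (s ^ S (2 * k) / (2 * INR k + 1) ^ 2
        - (- s) ^ S (2 * k) / (2 * INR k + 1) ^ 2) = s ^ S (2 * k) / (2 * INR k + 1) ^ 2).
      rewrite <- !tech_pow_Rmult, !pow_mult. replace ((- s) ^ 2) with (s ^ 2) by ring.
      field. pose proof (pos_INR k); lra.
    + change (/ 2 * (Li2 s - Li2 (- s)) = (Li2 s - Li2 (- s)) / 2); field.
  - intros k.
    change (/ 2 * (s ^ S (2 * k + 1) / INR (S (2 * k + 1)) ^ 2
        - (- s) ^ S (2 * k + 1) / INR (S (2 * k + 1)) ^ 2) = 0).
    replace (S (2 * k + 1)) with (2 * (k + 1))%nat by lia.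
    rewrite !pow_mult. replace ((- s) ^ 2) with (s ^ 2) by ring. ring.
Qed.

Lemma sin_INR_PI (n : nat) : sin (INR n * PI) = 0.
Proof.
  induction n as [|n IH]; [simpl; rewrite Rmult_0_l; apply sin_0|].
  rewrite S_INR, Rmult_plus_distr_r, Rmult_1_l, neg_sin, IH; ring.
Qed.

Lemma cos_INR_PI (n : nat) : cos (INR n * PI) = (-1) ^ n.
Proof.
  induction n as [|n IH]; [simpl; rewrite Rmult_0_l; apply cos_0|].
  rewrite S_INR, Rmult_plus_distr_r, Rmult_1_l, neg_cos, IH; simpl; ring.
Qed.

(** Since sin(n(pi - y)) = -(-1)^n sin(ny), the terms of even order cancel and those of odd order
    double. *)
Lemma Cl2_add_supplement (y : R) :
  is_series (fun k => sin ((2 * INR k + 1) * y) / (2 * INR k + 1) ^ 2)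
    ((Cl2 y + Cl2 (PI - y)) / 2).
Proof.
  assert (H : forall z, is_series (fun k => sin (INR (S k) * z) / INR (S k) ^ 2) (Cl2 z)).
  { intros z; apply Series_correct, (ex_series_bounded_div_sq (fun k => sin (INR (S k) * z))).
    intros k; apply Rabs_le, SIN_bound. }
  pose proof (is_series_plus _ _ _ _ (H y) (H (PI - y))) as Hd.
  apply (is_series_scal (/ 2)) in Hd.
  assert (Hs : forall n, sin (INR n * (PI - y)) = - (-1) ^ n * sin (INR n * y)).
  { intros n; rewrite Rmult_minus_distr_l, sin_minus, sin_INR_PI, cos_INR_PI; ring. }
  apply is_series_even_terms in Hd.
  - replace ((Cl2 y + Cl2 (PI - y)) / 2) with (scal (/ 2) (plus (Cl2 y) (Cl2 (PI - y)))).
    + apply is_series_ext with (2 := Hd); intros k; cbv beta.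
      rewrite Hs, pow_1_odd, INR_odd.
      change (/ 2 * (sin ((2 * INR k + 1) * y) / (2 * INR k + 1) ^ 2
        + - -1 * sin ((2 * INR k + 1) * y) / (2 * INR k + 1) ^ 2)
        = sin ((2 * INR k + 1) * y) / (2 * INR k + 1) ^ 2).
      field. pose proof (pos_INR k); lra.
    + change (/ 2 * (Cl2 y + Cl2 (PI - y)) = (Cl2 y + Cl2 (PI - y)) / 2); field.
  - intros k. cbv beta. rewrite Hs.
    replace (S (2 * k + 1)) with (2 * (k + 1))%nat by lia.
    rewrite pow_1_even. unfold scal, plus; simpl. unfold mult; simpl.
    unfold Rdiv; ring.
Qed.

(** * The integrals against a Poisson-type kernel *)

Lemma is_RInt_sq_mul_cos (k : nat) :
  is_RInt (fun x => x ^ 2 * cos ((2 * INR k + 1) * x)) 0 PI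
    (- 2 * PI / (2 * INR k + 1) ^ 2).
Proof.
  set (n := 2 * INR k + 1).
  assert (Hn : n <> 0) by (unfold n; pose proof (pos_INR k); lra).
  assert (Hs : sin (n * PI) = 0).
  { unfold n; rewrite <- INR_odd; apply sin_INR_PI. }
  assert (Hc : cos (n * PI) = -1).
  { unfold n; rewrite <- INR_odd, cos_INR_PI; apply pow_1_odd. }
  (* The primitive from integrating by parts twice. The sines vanish at both ends, so only the
     middle term at pi contributes. *)
  pose (F x := x ^ 2 * sin (n * x) / n + 2 * x * cos (n * x) / n ^ 2
                 - 2 * sin (n * x) / n ^ 3).
  replace (- 2 * PI / n ^ 2) with (minus (F PI) (F 0)).
  - apply is_RInt_derive with (f := F).
    + intros x _; unfold F; auto_derive; [exact I | field; exact Hn].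
    + intros x _. apply (ex_derive_continuous (V := R_NormedModule)).
      auto_derive; exact I.
  - change (F PI - F 0 = - 2 * PI / n ^ 2); unfold F.
    rewrite Hs, Hc, !Rmult_0_r, sin_0; field; exact Hn.
Qed.

Lemma is_RInt_sq_mul_sum (q : R) (N : nat) :
  is_RInt (fun x => x ^ 2 * sum_n (fun k => q ^ k * cos ((2 * INR k + 1) * x)) N) 0 PI
    (- 2 * PI * sum_n (fun k => q ^ k / (2 * INR k + 1) ^ 2) N).
Proof.
  induction N as [|N IH].
  - rewrite sum_O.
    replace (- 2 * PI * (q ^ 0 / (2 * INR 0 + 1) ^ 2))
      with (scal 1 (- 2 * PI / (2 * INR 0 + 1) ^ 2))
      by (unfold scal; simpl; unfold mult; simpl; field).
    apply is_RInt_ext with (2 := is_RInt_scal _ _ _ 1 _ (is_RInt_sq_mul_cos 0)).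
    intros x _; rewrite sum_O; unfold scal; simpl; unfold mult; simpl; ring.
  - rewrite sum_Sn.
    replace (- 2 * PI * plus (sum_n (fun k => q ^ k / (2 * INR k + 1) ^ 2) N)
                (q ^ S N / (2 * INR (S N) + 1) ^ 2))
      with (plus (- 2 * PI * sum_n (fun k => q ^ k / (2 * INR k + 1) ^ 2) N)
              (scal (q ^ S N) (- 2 * PI / (2 * INR (S N) + 1) ^ 2)))
      by (unfold plus, scal; cbn -[INR pow]; unfold mult; cbn -[INR pow]; unfold Rdiv; ring).
    apply is_RInt_ext with
      (2 := is_RInt_plus _ _ _ _ _ _ IH (is_RInt_scal _ _ _ (q ^ S N) _ (is_RInt_sq_mul_cos (S N)))).
    intros x _. rewrite sum_Sn.
    unfold plus, scal; cbn -[INR pow]; unfold mult; cbn -[INR pow]; ring.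
Qed.

(** The product formula [P] turns the factor 2 cos 2x into a shift of k by one in both directions,
    so the product telescopes. The lower end gives (1-q) cos x because the term before the first is
    cos(-x) = cos x; the upper end gives the remainder of order q^(N+1). *)
Lemma geometric_cos_odd_sum (q x : R) (N : nat) :
  (1 - 2 * q * cos (2 * x) + q ^ 2)
    * sum_n (fun k => q ^ k * cos ((2 * INR k + 1) * x)) N
  = (1 - q) * cos x
    - q ^ S N * (cos ((2 * INR N + 3) * x) - q * cos ((2 * INR N + 1) * x)).
Proof.
  assert (P : forall z, 2 * cos (2 * x) * cos z = cos (z + 2 * x) + cos (z - 2 * x)).
  { intros z; rewrite cos_plus, cos_minus; ring. }
  induction N as [|N IH].
  - rewrite sum_O; simpl (INR 0).
    pose proof (P x) as P0.
    replace (x - 2 * x) with (- x) in P0 by ring; rewrite cos_neg in P0.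
    replace ((2 * 0 + 3) * x) with (x + 2 * x) by ring.
    replace ((2 * 0 + 1) * x) with x by ring.
    replace (cos (x + 2 * x)) with (2 * cos (2 * x) * cos x - cos x) by lra.
    ring.
  - rewrite sum_Sn. change plus with Rplus; cbv beta.
    rewrite Rmult_plus_distr_l, IH, S_INR.
    replace ((2 * INR N + 3) * x) with ((2 * (INR N + 1) + 1) * x) by ring.
    set (z := (2 * (INR N + 1) + 1) * x).
    replace ((2 * INR N + 1) * x) with (z - 2 * x) by (unfold z; ring).
    replace ((2 * (INR N + 1) + 3) * x) with (z + 2 * x) by (unfold z; ring).
    replace (cos (z + 2 * x)) with (2 * cos (2 * x) * cos z - cos (z - 2 * x))
      by (rewrite P; ring).
    rewrite <- !tech_pow_Rmult. ring.
Qed.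

(** For |q| < 1 this keeps the kernel continuous and bounds the remainder uniformly in x. *)
Lemma poisson_denominator_ge (q x : R) :
  (1 - Rabs q) ^ 2 <= 1 - 2 * q * cos (2 * x) + q ^ 2.
Proof.
  assert (q * cos (2 * x) <= Rabs q).
  { pose proof (COS_bound (2 * x)). unfold Rabs; destruct (Rcase_abs q); nra. }
  rewrite <- (pow2_abs q). nra.
Qed.

(** The explicit remainder replaces any exchange of limit and integral: (1-q) times the integral
    differs from the integrated finite sum by O(|q|^(N+1)), and N tends to infinity. *)
Lemma is_RInt_sq_mul_cos_div_poisson (q : R) : Rabs q < 1 ->
  is_RInt (fun x => x ^ 2 * cos x / (1 - 2 * q * cos (2 * x) + q ^ 2)) 0 PI
    (- 2 * PI / (1 - q) * Series (fun k => q ^ k / (2 * INR k + 1) ^ 2)).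
Proof.
  intros Hq.
  assert (Hq1 : 0 < 1 - q) by (pose proof (Rle_abs q); lra).
  assert (Hc : 0 < (1 - Rabs q) ^ 2) by (apply pow_lt; lra).
  assert (HD : forall x, 0 < 1 - 2 * q * cos (2 * x) + q ^ 2).
  { intros x; pose proof (poisson_denominator_ge q x); lra. }
  set (f x := x ^ 2 * cos x / (1 - 2 * q * cos (2 * x) + q ^ 2)).
  assert (Hf : ex_RInt f 0 PI).
  { apply (ex_RInt_continuous (V := R_CompleteNormedModule)); intros x _.
    apply (ex_derive_continuous (V := R_NormedModule)).
    unfold f; auto_derive; pose proof (HD x); simpl in *; lra. }
  apply (RInt_correct (V := R_CompleteNormedModule)) in Hf.
  set (I := RInt f 0 PI : R) in *.
  pose (S_ := sum_n (fun k => q ^ k / (2 * INR k + 1) ^ 2) : nat -> R).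
  (* The constant collects the length pi of the interval, x^2 <= pi^2, the bound 2 on the two
     boundary cosines [e], and the lower bound on the denominator. *)
  assert (Hb : forall N, Rabs ((1 - q) * I + 2 * PI * S_ N)
                 <= PI * (PI ^ 2 * (2 / (1 - Rabs q) ^ 2)) * Rabs q ^ S N).
  { intros N.
    pose proof (is_RInt_minus _ _ _ _ _ _ (is_RInt_scal _ _ _ (1 - q) _ Hf)
                  (is_RInt_sq_mul_sum q N)) as H.
    apply (norm_RInt_le_const _ _ _ _ (PI ^ 2 * (2 / (1 - Rabs q) ^ 2) * Rabs q ^ S N)) in H.
    - replace ((1 - q) * I + 2 * PI * S_ N) with ((1 - q) * I - (- 2 * PI * S_ N)) by ring.
      eapply Rle_trans; [exact H | right; ring].
    - pose proof PI_RGT_0; lra.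
    - intros x Hx.
      change (Rabs ((1 - q) * f x
         - x ^ 2 * sum_n (fun k => q ^ k * cos ((2 * INR k + 1) * x)) N)
         <= PI ^ 2 * (2 / (1 - Rabs q) ^ 2) * Rabs q ^ S N).
      pose proof (geometric_cos_odd_sum q x N) as G.
      set (s := sum_n (fun k => q ^ k * cos ((2 * INR k + 1) * x)) N) in *.
      set (e := cos ((2 * INR N + 3) * x) - q * cos ((2 * INR N + 1) * x)) in *.
      set (D := 1 - 2 * q * cos (2 * x) + q ^ 2) in *.
      assert (HDx : (1 - Rabs q) ^ 2 <= D) by apply poisson_denominator_ge.
      replace ((1 - q) * f x - x ^ 2 * s) with (x ^ 2 * (e * / D) * q ^ S N).
      2:{ replace s with ((D * s) / D) by (field; lra). rewrite G.
          unfold f; fold D. field; lra. }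
      assert (He : Rabs e <= 2).
      { unfold e. eapply Rle_trans; [apply Rabs_triang|].
        rewrite Rabs_Ropp, Rabs_mult.
        assert (HH : forall y, Rabs (cos y) <= 1) by (intros; apply Rabs_le, COS_bound).
        pose proof (HH ((2 * INR N + 3) * x)). pose proof (HH ((2 * INR N + 1) * x)).
        pose proof (Rabs_pos q). pose proof (Rabs_pos (cos ((2 * INR N + 1) * x))). nra. }
      rewrite 3!Rabs_mult, RPow_abs, (Rabs_right (x ^ 2)) by (apply Rle_ge, pow2_ge_0).
      assert (0 < / D) by (apply Rinv_0_lt_compat; lra).
      rewrite (Rabs_right (/ D)) by lra.
      apply Rmult_le_compat_r; [apply Rabs_pos|].
      apply Rmult_le_compat.
      + apply pow2_ge_0.
      + apply Rmult_le_pos; [apply Rabs_pos | lra].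
      + apply pow_incr; exact Hx.
      + apply Rmult_le_compat; [apply Rabs_pos | lra | exact He |].
        apply Rinv_le_contravar; assumption. }
  assert (HS : is_lim_seq S_ (Series (fun k => q ^ k / (2 * INR k + 1) ^ 2))).
  { apply Series_correct.
    apply (ex_series_le (V := R_CompleteNormedModule)) with (b := fun k => Rabs q ^ k).
    2:{ exists (/ (1 - Rabs q)); apply is_series_geom; now rewrite Rabs_Rabsolu. }
    intros k; change norm with Rabs.
    pose proof (pos_INR k). pose proof (Rabs_pos (q ^ k)).
    assert (0 < / (2 * INR k + 1) ^ 2 <= 1).
    { split; [apply Rinv_0_lt_compat, pow_lt; lra |].
      apply Rle_trans with (/ 1); [apply Rinv_le_contravar; nra | rewrite Rinv_1; lra]. }
    unfold Rdiv; rewrite Rabs_mult, (Rabs_right (/ _)), <- RPow_abs in * by lra.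
    nra. }
  set (L := Series (fun k => q ^ k / (2 * INR k + 1) ^ 2)) in *.
  (* The same sequence converges to this expression and, by [Hb], to 0. *)
  assert (H0 : (1 - q) * I + 2 * PI * L = 0).
  { assert (H1 : is_lim_seq (fun N => (1 - q) * I + 2 * PI * S_ N) ((1 - q) * I + 2 * PI * L)).
    { apply is_lim_seq_plus'; [apply is_lim_seq_const|].
      apply (is_lim_seq_scal_l S_ (2 * PI) L), HS. }
    assert (H2 : is_lim_seq (fun N => (1 - q) * I + 2 * PI * S_ N) 0).
    { apply is_lim_seq_abs_0.
      eapply is_lim_seq_le_le; [intros N; split; [apply Rabs_pos | apply Hb]
        | apply is_lim_seq_const |].
      replace (Finite 0) with (Rbar_mult (PI * (PI ^ 2 * (2 / (1 - Rabs q) ^ 2))) 0)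
        by (simpl; f_equal; ring).
      apply is_lim_seq_scal_l.
      apply (is_lim_seq_incr_1 (fun N => Rabs q ^ N)), is_lim_seq_geom.
      now rewrite Rabs_Rabsolu. }
    apply is_lim_seq_unique in H1. apply is_lim_seq_unique in H2.
    rewrite H1 in H2. now injection H2. }
  replace (- 2 * PI / (1 - q) * L) with I; [exact Hf|].
  apply Rmult_eq_reg_l with (1 - q); [|lra].
  replace ((1 - q) * (- 2 * PI / (1 - q) * L)) with (- (2 * PI * L)) by (field; lra).
  lra.
Qed.

(** * Fourier series of ln tan and the inverse tangent integral *)

(** The mean value theorem applies to [g - c * h] with c = 1 and c = -1, whose derivative is
    nonnegative. A general [g] is allowed because the arctangent estimate compares with a monomial
    rather than a linear function. *)
Lemma derive_dominated (h g dh dg : R -> R) (a b : R) : a <= b ->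
  (forall x, a <= x <= b -> is_derive h x (dh x)) ->
  (forall x, a <= x <= b -> is_derive g x (dg x)) ->
  (forall x, a <= x <= b -> Rabs (dh x) <= dg x) ->
  Rabs (h b - h a) <= g b - g a.
Proof.
  intros Hab Hh Hg Hd.
  assert (Hmono : forall c, Rabs c = 1 -> c * (h b - h a) <= g b - g a).
  { intros c Hc.
    destruct (MVT_gen (fun x => g x - c * h x) a b (fun x => dg x - c * dh x)) as [x [Hx E]].
    - intros x; rewrite Rmin_left, Rmax_right by lra; intros Hx.
      apply (is_derive_minus (V := R_NormedModule) g (fun y => c * h y) x (dg x) (c * dh x));
        [apply Hg; lra|].
      apply (is_derive_scal h x c (dh x)), Hh; lra.
    - intros x; rewrite Rmin_left, Rmax_right by lra; intros Hx.
      apply continuity_pt_filterlim.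
      apply (ex_derive_continuous (V := R_NormedModule) (fun x => g x - c * h x)).
      exists (dg x - c * dh x); apply (is_derive_minus (V := R_NormedModule) g (fun y => c * h y) x (dg x) (c * dh x));
        [apply Hg; lra|].
      apply (is_derive_scal h x c (dh x)), Hh; lra.
    - rewrite Rmin_left, Rmax_right in Hx by lra.
      assert (0 <= dg x - c * dh x).
      { specialize (Hd x Hx). pose proof (Rle_abs (c * dh x)) as A.
        rewrite Rabs_mult, Hc in A. lra. }
      assert (0 <= (dg x - c * dh x) * (b - a)) by (apply Rmult_le_pos; lra).
      lra. }
  apply Rabs_le; split.
  - specialize (Hmono (-1)); rewrite Rabs_left in Hmono by lra; lra.
  - specialize (Hmono 1); rewrite Rabs_R1 in Hmono; lra.
Qed.

(** Telescoping of 2 sin(2t) sin((2k+1)2t) = cos(4kt) - cos(4(k+1)t). The factor -4 is the one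
    produced by differentiating the cosine sum in [ln_tan_fourier_error]. *)
Lemma sum_sin_odd (t : R) (N : nat) :
  sin (2 * t) * sum_n (fun k => - 4 * sin ((2 * INR k + 1) * (2 * t))) N
  = 2 * cos (4 * INR (S N) * t) - 2.
Proof.
  induction N as [|N IH].
  - rewrite sum_O, S_INR; simpl (INR 0).
    replace ((2 * 0 + 1) * (2 * t)) with (2 * t) by ring.
    replace (4 * (0 + 1) * t) with (2 * (2 * t)) by ring.
    rewrite cos_2a_sin; ring.
  - rewrite sum_Sn, (S_INR (S N)). change plus with Rplus; cbv beta.
    rewrite Rmult_plus_distr_l, IH.
    replace (4 * INR (S N) * t) with ((2 * INR (S N) + 1) * (2 * t) - 2 * t) by ring.
    replace (4 * (INR (S N) + 1) * t) with ((2 * INR (S N) + 1) * (2 * t) + 2 * t) by ring.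
    rewrite cos_plus, cos_minus; ring.
Qed.

Lemma cos_odd_PI2 (k : nat) : cos ((2 * INR k + 1) * (PI / 2)) = 0.
Proof.
  replace ((2 * INR k + 1) * (PI / 2)) with (INR k * PI + PI / 2) by field.
  rewrite cos_plus, cos_PI2, sin_INR_PI; ring.
Qed.

Lemma sum_n_zero (u : nat -> R) (N : nat) : (forall k, u k = 0) -> sum_n u N = 0.
Proof.
  intros Hu; induction N as [|N IH]; [rewrite sum_O; apply Hu|].
  rewrite sum_Sn, IH, Hu; apply Rplus_0_l.
Qed.

(** The error vanishes at pi/4, where every cosine is 0 and tan is 1, so it is controlled by its
    derivative on [t, pi/4]. Stating the bound through [a] makes it uniform in t, as needed when it
    serves as a derivative bound in [inverse_tangent_sum_error]. *)
Lemma ln_tan_fourier_error (a t : R) (N : nat) : 0 < a <= t -> t <= PI / 4 ->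
  Rabs (sum_n (fun k => 2 * cos ((2 * INR k + 1) * (2 * t)) / (2 * INR k + 1)) N
        + ln (tan t))
  <= 2 / sin (2 * a) ^ 2 / INR (S N).
Proof.
  intros Ha Ht.
  pose proof PI_4 as HPI4.
  assert (HM : 0 < INR (S N)) by (apply lt_0_INR; lia).
  set (M := INR (S N)) in *.
  assert (Hsa : 0 < sin (2 * a)) by (apply sin_gt_0; lra).
  assert (Hsin : forall x, t <= x <= PI / 4 -> sin (2 * a) <= sin (2 * x) /\ 0 < tan x
                  /\ 0 < cos x /\ 0 < sin x).
  { intros x Hx; repeat split.
    - apply sin_incr_1; lra.
    - apply tan_gt_0; lra.
    - apply cos_gt_0; lra.
    - apply sin_gt_0; lra. }
  (* Subtracting sin(4Mx)/(2M sin 2x) integrates the oscillating derivative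
     2 cos(4Mx)/sin 2x of the error by parts, leaving a derivative O(1/M). *)
  pose (E x := sum_n (fun k => 2 * cos ((2 * INR k + 1) * (2 * x)) / (2 * INR k + 1)) N
               + ln (tan x) - sin (4 * M * x) / (2 * M * sin (2 * x))).
  assert (HE : Rabs (E (PI / 4) - E t)
    <= (/ (M * sin (2 * a) ^ 2)) * (PI / 4) - (/ (M * sin (2 * a) ^ 2)) * t).
  { apply (derive_dominated E (fun x => / (M * sin (2 * a) ^ 2) * x)
      (fun x => sin (4 * M * x) * cos (2 * x) / (M * sin (2 * x) ^ 2))
      (fun x => / (M * sin (2 * a) ^ 2))); [lra| | |].
    - intros x Hx. destruct (Hsin x Hx) as [H2 [H3 [H4 H5]]].
      assert (HS : is_derive
        (fun y => sum_n (fun k => 2 * cos ((2 * INR k + 1) * (2 * y)) / (2 * INR k + 1)) N) x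
        (sum_n (fun k => - 4 * sin ((2 * INR k + 1) * (2 * x))) N)).
      { apply (is_derive_sum_n (V := R_NormedModule)
          (fun k y => 2 * cos ((2 * INR k + 1) * (2 * y)) / (2 * INR k + 1))).
        intros k _. auto_derive; [exact I|]. field. pose proof (pos_INR k); lra. }
      assert (HL : is_derive (fun y => ln (tan y)) x (2 / sin (2 * x))).
      { apply is_derive_ext_loc with (f := fun y => ln (sin y / cos y)).
        - apply filter_forall; intros y; reflexivity.
        - auto_derive.
          + repeat split; [lra|]. apply Rmult_lt_0_compat; [lra|]. apply Rinv_0_lt_compat; lra.
          + rewrite sin_2a. field_simplify; [|lra|lra].
            replace (sin x ^ 2) with (1 - cos x ^ 2) by (pose proof (sin2_cos2 x); unfold Rsqr in *; lra).
            field; lra. }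
      assert (HR : is_derive (fun y => sin (4 * M * y) / (2 * M * sin (2 * y))) x
         (2 * cos (4 * M * x) / sin (2 * x)
           - sin (4 * M * x) * cos (2 * x) / (M * sin (2 * x) ^ 2))).
      { auto_derive; [apply Rmult_integral_contrapositive; lra|].
        field; lra. }
      pose proof (is_derive_minus _ _ _ _ _ (is_derive_plus _ _ _ _ _ HS HL) HR) as H.
      match type of H with is_derive _ _ ?d => replace (sin (4 * M * x) * cos (2 * x) / (M * sin (2 * x) ^ 2)) with d; [exact H|] end.
      unfold minus, plus, opp; cbn -[INR pow sum_n].
      pose proof (sum_sin_odd x N) as G; fold M in G.
      set (s := sum_n (fun k => - 4 * sin ((2 * INR k + 1) * (2 * x))) N) in *.
      change (s + 2 / sin (2 * x) + - (2 * cos (4 * M * x) / sin (2 * x)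
           - sin (4 * M * x) * cos (2 * x) / (M * sin (2 * x) ^ 2)) =
        sin (4 * M * x) * cos (2 * x) / (M * sin (2 * x) ^ 2)).
      (* The part -2/sin(2x) cancels the derivative of ln tan, and the oscillating part cancels
         against the derivative of the correction term. *)
      replace s with ((2 * cos (4 * M * x) - 2) / sin (2 * x))
        by (rewrite <- G; field; lra).
      field; lra.
    - intros x _; generalize (/ (M * sin (2 * a) ^ 2)); intros k.
      auto_derive; [exact I | ring].
    - intros x Hx. destruct (Hsin x Hx) as [H2 _].
      unfold Rdiv; rewrite Rabs_mult.
      assert (P : 0 < M * sin (2 * a) ^ 2) by (apply Rmult_lt_0_compat; [lra | apply pow_lt; lra]).
      assert (P' : M * sin (2 * a) ^ 2 <= M * sin (2 * x) ^ 2).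
      { apply Rmult_le_compat_l; [lra|]. apply pow_incr; lra. }
      rewrite (Rabs_right (/ _)) by (left; apply Rinv_0_lt_compat; lra).
      assert (Rabs (sin (4 * M * x) * cos (2 * x)) <= 1).
      { rewrite Rabs_mult.
        assert (Rabs (sin (4 * M * x)) <= 1) by apply Rabs_le, SIN_bound.
        assert (Rabs (cos (2 * x)) <= 1) by apply Rabs_le, COS_bound.
        pose proof (Rabs_pos (sin (4 * M * x))). pose proof (Rabs_pos (cos (2 * x))). nra. }
      rewrite <- (Rmult_1_l (/ (M * sin (2 * a) ^ 2))).
      apply Rmult_le_compat; [apply Rabs_pos | left; apply Rinv_0_lt_compat; lra | assumption |].
      apply Rinv_le_contravar; assumption. }
  assert (E0 : E (PI / 4) = 0).
  { unfold E. rewrite sum_n_zero.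
    - replace (4 * M * (PI / 4)) with (M * PI) by field.
      unfold M; rewrite sin_INR_PI, tan_PI4, ln_1; unfold Rdiv; ring.
    - intros k. replace (2 * (PI / 4)) with (PI / 2) by field.
      rewrite cos_odd_PI2; unfold Rdiv; ring. }
  rewrite E0 in HE.
  destruct (Hsin t ltac:(lra)) as [H2 _].
  assert (B : Rabs (sin (4 * M * t) / (2 * M * sin (2 * t))) <= / (2 * M * sin (2 * a))).
  { unfold Rdiv; rewrite Rabs_mult.
    assert (0 < 2 * M * sin (2 * a)) by nra.
    assert (2 * M * sin (2 * a) <= 2 * M * sin (2 * t)) by nra.
    rewrite (Rabs_right (/ _)) by (left; apply Rinv_0_lt_compat; lra).
    rewrite <- (Rmult_1_l (/ (2 * M * sin (2 * a)))).
    apply Rmult_le_compat; [apply Rabs_pos | left; apply Rinv_0_lt_compat; lra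
      | apply Rabs_le, SIN_bound |].
    apply Rinv_le_contravar; assumption. }
  match goal with |- Rabs ?u <= _ => replace u with
    (- (0 - E t) + sin (4 * M * t) / (2 * M * sin (2 * t))) by (unfold E; ring) end.
  eapply Rle_trans; [apply Rabs_triang|]. rewrite Rabs_Ropp.
  assert (Q : / (2 * M * sin (2 * a)) <= / (M * sin (2 * a) ^ 2)).
  { apply Rinv_le_contravar; [apply Rmult_lt_0_compat; [lra | apply pow_lt; lra]|].
    pose proof (SIN_bound (2 * a)).
    assert (0 < M * sin (2 * a)) by (apply Rmult_lt_0_compat; lra).
    nra. }
  assert (0 < / (M * sin (2 * a) ^ 2))
    by (apply Rinv_0_lt_compat, Rmult_lt_0_compat; [lra | apply pow_lt; lra]).
  (* The factor 2 counts two errors, each at most 1/(M sin(2a)^2): the variation of [E], since the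
     interval has length at most pi/4 <= 1, and the correction term, by [Q]. *)
  replace (2 / sin (2 * a) ^ 2 / M) with (2 * / (M * sin (2 * a) ^ 2)) by (field; lra).
  nra.
Qed.

Lemma is_derive_odd_monomial (a b u : R) (k : nat) :
  is_derive (fun v => a * v ^ S (2 * k) / b) u (a * ((2 * INR k + 1) * u ^ (2 * k)) / b).
Proof.
  auto_derive; [exact I|].
  change (a * (1 * (INR (S (2 * k)) * u ^ (2 * k))) * / b
          = a * ((2 * INR k + 1) * u ^ (2 * k)) / b).
  rewrite INR_odd; unfold Rdiv; ring.
Qed.

Lemma geometric_sum_neg (y : R) (N : nat) :
  (1 + y) * sum_n (fun k => (- y) ^ k) N = 1 - (- y) ^ S N.
Proof.
  induction N as [|N IH]; [rewrite sum_O; ring|].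
  rewrite sum_Sn; change plus with Rplus; cbv beta.
  rewrite Rmult_plus_distr_l, IH, <- !tech_pow_Rmult; ring.
Qed.

(** The derivative of the error is the geometric tail (-v^2)^(N+1)/(1+v^2), dominated by v^(2N+2).
    Integrating gives u^(2N+3)/(2N+3), weakened to 1/(N+1) to match the rate of
    [ln_tan_fourier_error]. *)
Lemma atan_taylor_error (u : R) (N : nat) : 0 <= u <= 1 ->
  Rabs (atan u - sum_n (fun k => (-1) ^ k * u ^ S (2 * k) / (2 * INR k + 1)) N)
    <= / INR (S N).
Proof.
  intros Hu.
  assert (HN : 0 < INR (S N)) by (apply lt_0_INR; lia).
  pose (A v := sum_n (fun k => (-1) ^ k * v ^ S (2 * k) / (2 * INR k + 1)) N).
  assert (H : Rabs ((atan u - A u) - (atan 0 - A 0))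
              <= u ^ S (2 * S N) / (2 * INR (S N) + 1) - 0 ^ S (2 * S N) / (2 * INR (S N) + 1)).
  { apply (derive_dominated (fun v => atan v - A v)
      (fun v => v ^ S (2 * S N) / (2 * INR (S N) + 1))
      (fun v => / (1 + v ^ 2) - sum_n (fun k => (- v ^ 2) ^ k) N)
      (fun v => v ^ (2 * S N))); [lra| | |].
    - intros v _.
      apply (is_derive_minus (V := R_NormedModule) atan A).
      + replace (v ^ 2) with (Rsqr v) by (unfold Rsqr; ring). apply is_derive_atan.
      + apply (is_derive_sum_n (V := R_NormedModule)
          (fun k v => (-1) ^ k * v ^ S (2 * k) / (2 * INR k + 1))).
        intros k _.
        replace ((- v ^ 2) ^ k)
          with ((-1) ^ k * ((2 * INR k + 1) * v ^ (2 * k)) / (2 * INR k + 1)).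
        * apply is_derive_odd_monomial.
        * replace (- v ^ 2) with (-1 * v ^ 2) by ring.
          rewrite Rpow_mult_distr, <- pow_mult. field. pose proof (pos_INR k); lra.
    - intros v _.
      apply is_derive_ext with (f := fun v => 1 * v ^ S (2 * S N) / (2 * INR (S N) + 1)).
      { intros w; now rewrite Rmult_1_l. }
      replace (v ^ (2 * S N))
        with (1 * ((2 * INR (S N) + 1) * v ^ (2 * S N)) / (2 * INR (S N) + 1)) by (field; lra).
      apply is_derive_odd_monomial.
    - intros v _.
      pose proof (pow2_ge_0 v).
      replace (/ (1 + v ^ 2) - sum_n (fun k => (- v ^ 2) ^ k) N)
        with ((- v ^ 2) ^ S N * / (1 + v ^ 2)).
      2:{ apply Rmult_eq_reg_l with (1 + v ^ 2); [|lra].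
          rewrite Rmult_minus_distr_l, geometric_sum_neg. field; lra. }
      rewrite Rabs_mult, <- RPow_abs, Rabs_Ropp, (Rabs_right (v ^ 2)) by lra.
      rewrite (Rabs_right (/ _)) by (left; apply Rinv_0_lt_compat; lra).
      rewrite <- pow_mult.
      assert (0 <= v ^ (2 * S N)) by (rewrite pow_mult; now apply pow_le).
      assert (/ (1 + v ^ 2) <= 1).
      { apply Rle_trans with (/ 1); [apply Rinv_le_contravar; lra | rewrite Rinv_1; lra]. }
      nra. }
  assert (A0 : A 0 = 0).
  { apply sum_n_zero; intros k; rewrite <- tech_pow_Rmult; unfold Rdiv; ring. }
  rewrite A0, atan_0, !Rminus_0_r in H.
  eapply Rle_trans; [exact H|].
  rewrite <- (tech_pow_Rmult 0).
  assert (u ^ S (2 * S N) <= 1) by (rewrite <- (pow1 (S (2 * S N))); now apply pow_incr).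
  assert (/ (2 * INR (S N) + 1) <= / INR (S N)) by (apply Rinv_le_contravar; lra).
  assert (0 < / (2 * INR (S N) + 1)) by (apply Rinv_0_lt_compat; lra).
  unfold Rdiv. nra.
Qed.

Lemma sin_odd_PI2 (k : nat) : sin ((2 * INR k + 1) * (PI / 2)) = (-1) ^ k.
Proof.
  replace ((2 * INR k + 1) * (PI / 2)) with (INR k * PI + PI / 2) by field.
  rewrite sin_plus, cos_PI2, sin_PI2, cos_INR_PI; ring.
Qed.

(** The derivative of the error splits into the Fourier error of ln tan and the Taylor error of
    arctan times (tan^2 x + 1)/tan x = 2/sin(2x). These give the two summands of the constant. *)
Lemma inverse_tangent_sum_error (t : R) (N : nat) : 0 < t <= PI / 4 ->
  Rabs (sum_n (fun k => sin ((2 * INR k + 1) * (2 * t)) / (2 * INR k + 1) ^ 2) N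
        - sum_n (fun k => (-1) ^ k * tan t ^ S (2 * k) / (2 * INR k + 1) ^ 2) N
        + t * ln (tan t))
  <= (2 / sin (2 * t) ^ 2 + 2 / sin (2 * t)) * (PI / 4 - t) / INR (S N).
Proof.
  intros Ht.
  assert (HM : 0 < INR (S N)) by (apply lt_0_INR; lia).
  assert (Hst : 0 < sin (2 * t)) by (apply sin_gt_0; lra).
  pose (C x := sum_n (fun k => sin ((2 * INR k + 1) * (2 * x)) / (2 * INR k + 1) ^ 2) N).
  pose (T u := sum_n (fun k => (-1) ^ k * u ^ S (2 * k) / (2 * INR k + 1) ^ 2) N).
  pose (D x := sum_n (fun k => 2 * cos ((2 * INR k + 1) * (2 * x)) / (2 * INR k + 1)) N).
  pose (A u := sum_n (fun k => (-1) ^ k * u ^ S (2 * k) / (2 * INR k + 1)) N).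
  pose (G x := C x - T (tan x) + x * ln (tan x)).
  set (K := (2 / sin (2 * t) ^ 2 + 2 / sin (2 * t)) / INR (S N)).
  assert (HG : Rabs (G (PI / 4) - G t) <= K * (PI / 4) - K * t).
  { apply (derive_dominated G (fun x => K * x)
      (fun x => (D x + ln (tan x)) + (x - A (tan x)) * ((tan x ^ 2 + 1) / tan x))
      (fun _ => K)); [lra| | |].
    - intros x Hx.
      assert (Hc : 0 < cos x) by (apply cos_gt_0; lra).
      assert (Htan : 0 < tan x) by (apply tan_gt_0; lra).
      assert (HC : is_derive C x (D x)).
      { apply (is_derive_sum_n (V := R_NormedModule)
          (fun k x => sin ((2 * INR k + 1) * (2 * x)) / (2 * INR k + 1) ^ 2)).
        intros k _. auto_derive; [exact I|]. field. pose proof (pos_INR k); lra. }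
      (* Termwise, u T'(u) = A(u): differentiation removes one factor 2k+1 and one power of u. *)
      assert (HT : is_derive T (tan x) (A (tan x) * / tan x)).
      { unfold A. rewrite <- (sum_n_mult_r (K := R_Ring) (/ tan x)).
        apply (is_derive_sum_n (V := R_NormedModule)
          (fun k u => (-1) ^ k * u ^ S (2 * k) / (2 * INR k + 1) ^ 2)).
        intros k _.
        match goal with |- is_derive _ _ ?d => replace d
          with ((-1) ^ k * ((2 * INR k + 1) * tan x ^ (2 * k)) / (2 * INR k + 1) ^ 2) end.
        - apply is_derive_odd_monomial.
        - rewrite <- (tech_pow_Rmult (tan x)). change mult with Rmult; cbv beta.
          field. pose proof (pos_INR k); lra. }
      assert (Hd : is_derive tan x (tan x ^ 2 + 1)) by (apply is_derive_tan; lra).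
      assert (HL : is_derive (fun y => y * ln (tan y)) x
                     (ln (tan x) + x * ((tan x ^ 2 + 1) / tan x))).
      { apply (is_derive_ext (fun y => y * (fun z => ln (tan z)) y)); [reflexivity|].
        assert (Hl : is_derive (fun z => ln (tan z)) x ((tan x ^ 2 + 1) / tan x)).
        { apply (is_derive_comp ln tan x (/ tan x)); [now apply is_derive_ln | exact Hd]. }
        replace (ln (tan x) + x * ((tan x ^ 2 + 1) / tan x))
          with (1 * ln (tan x) + x * ((tan x ^ 2 + 1) / tan x)) by ring.
        apply (is_derive_mult (fun y => y) (fun z => ln (tan z)));
          [exact (is_derive_id (K := R_AbsRing) x) | exact Hl | intros; apply Rmult_comm]. }
      pose proof (is_derive_plus _ _ _ _ _
        (is_derive_minus _ _ _ _ _ HC (is_derive_comp T tan x _ _ HT Hd)) HL) as H.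
      match type of H with is_derive _ _ ?d =>
        replace (D x + ln (tan x) + (x - A (tan x)) * ((tan x ^ 2 + 1) / tan x)) with d;
          [exact H|] end.
      change (D x - (tan x ^ 2 + 1) * (A (tan x) * / tan x)
                + (ln (tan x) + x * ((tan x ^ 2 + 1) / tan x))
              = D x + ln (tan x) + (x - A (tan x)) * ((tan x ^ 2 + 1) / tan x)).
      field; lra.
    - intros x _. generalize K; intros K'; auto_derive; [exact I | ring].
    - intros x Hx.
      assert (Hc : 0 < cos x) by (apply cos_gt_0; lra).
      assert (Hs : 0 < sin x) by (apply sin_gt_0; lra).
      assert (Htan : 0 < tan x) by (apply tan_gt_0; lra).
      assert (Htan1 : tan x <= 1).
      { destruct (Req_dec x (PI / 4)) as [->|]; [rewrite tan_PI4; lra|].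
        left; rewrite <- tan_PI4; apply tan_increasing; lra. }
      assert (Hsx : sin (2 * t) <= sin (2 * x)) by (apply sin_incr_1; lra).
      assert (E : (tan x ^ 2 + 1) / tan x = 2 / sin (2 * x)).
      { rewrite sin_2a; unfold tan; field_simplify; [|lra|lra].
        replace (sin x ^ 2) with (1 - cos x ^ 2)
          by (pose proof (sin2_cos2 x); unfold Rsqr in *; lra).
        field; lra. }
      rewrite E.
      eapply Rle_trans; [apply Rabs_triang|].
      unfold K; rewrite Rdiv_plus_distr. apply Rplus_le_compat.
      + apply ln_tan_fourier_error; lra.
      + pose proof (atan_taylor_error (tan x) N ltac:(lra)) as B.
        fold (A (tan x)) in B. rewrite atan_tan in B by lra.
        rewrite Rabs_mult, (Rmult_comm (Rabs _)).
        assert (0 < / sin (2 * x)) by (apply Rinv_0_lt_compat; lra).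
        rewrite (Rabs_right (2 / _)) by (unfold Rdiv; lra).
        unfold Rdiv at 2. apply Rmult_le_compat; [unfold Rdiv; lra | apply Rabs_pos | | exact B].
        apply Rmult_le_compat_l; [lra|]. apply Rinv_le_contravar; lra. }
  (* At pi/4 the finite sums agree term by term, since sin((2k+1)pi/2) = (-1)^k, and the logarithm
     vanishes. *)
  assert (G0 : G (PI / 4) = 0).
  { unfold G. rewrite tan_PI4, ln_1. replace (C (PI / 4)) with (T 1); [ring|].
    apply sum_n_ext; intros k. rewrite pow1.
    replace (2 * (PI / 4)) with (PI / 2) by field.
    now rewrite sin_odd_PI2, Rmult_1_r. }
  rewrite G0 in HG.
  change (Rabs (G t) <= (2 / sin (2 * t) ^ 2 + 2 / sin (2 * t)) * (PI / 4 - t) / INR (S N)).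
  rewrite <- Rabs_Ropp. replace (- G t) with (0 - G t) by ring.
  eapply Rle_trans; [exact HG|]. unfold K; right; field; lra.
Qed.

Lemma is_lim_seq_inv_INR_S : is_lim_seq (fun n => / INR (S n)) 0.
Proof.
  apply (is_lim_seq_incr_1 (fun n => / INR n)).
  replace (Finite 0) with (Rbar_inv p_infty) by reflexivity.
  apply is_lim_seq_inv; [apply is_lim_seq_INR | discriminate].
Qed.

(** For fixed t the error bound tends to 0, so the limit of the sine sums given by
    [Cl2_add_supplement] determines that of the arctangent-type sums. *)
Lemma inverse_tangent_integral_Cl2 (t : R) : 0 < t < PI / 4 ->
  is_series (fun k => (-1) ^ k * tan t ^ S (2 * k) / (2 * INR k + 1) ^ 2)
    ((Cl2 (2 * t) + Cl2 (PI - 2 * t)) / 2 + t * ln (tan t)).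
Proof.
  intros Ht.
  pose proof (Cl2_add_supplement (2 * t)) as HC.
  set (c := (Cl2 (2 * t) + Cl2 (PI - 2 * t)) / 2) in *.
  pose (C := sum_n (fun k => sin ((2 * INR k + 1) * (2 * t)) / (2 * INR k + 1) ^ 2) : nat -> R).
  pose (T := sum_n (fun k => (-1) ^ k * tan t ^ S (2 * k) / (2 * INR k + 1) ^ 2) : nat -> R).
  change (is_lim_seq C c) in HC. change (is_lim_seq T (c + t * ln (tan t))).
  apply is_lim_seq_ext with
    (fun N => C N + t * ln (tan t) - (C N - T N + t * ln (tan t))); [intros N; ring|].
  replace (c + t * ln (tan t)) with (c + t * ln (tan t) - 0) by ring.
  apply is_lim_seq_minus'.
  - apply is_lim_seq_plus'; [exact HC | apply is_lim_seq_const].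
  - apply is_lim_seq_abs_0.
    eapply is_lim_seq_le_le; [intros N; split; [apply Rabs_pos
      | apply (inverse_tangent_sum_error t N); lra] | apply is_lim_seq_const |].
    match goal with |- is_lim_seq (fun n => ?a / INR (S n)) _ =>
      replace (Finite 0) with (Rbar_mult a 0) by (simpl; f_equal; ring) end.
    apply is_lim_seq_scal_l, is_lim_seq_inv_INR_S.
Qed.

(** * Lucas numbers and the two integrals *)

Lemma beta_bounds : -1 < beta < 0.
Proof.
  unfold beta.
  assert (1 < sqrt 5) by (rewrite <- sqrt_1; apply sqrt_lt_1; lra).
  assert (sqrt 5 < 3).
  { replace 3 with (sqrt (3 * 3)) by (apply sqrt_square; lra). apply sqrt_lt_1; lra. }
  lra.
Qed.

Lemma beta_sq : beta ^ 2 = beta + 1.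
Proof.
  unfold beta. assert (H : sqrt 5 * sqrt 5 = 5) by (apply sqrt_sqrt; lra).
  replace (((1 - sqrt 5) / 2) ^ 2) with ((1 - 2 * sqrt 5 + sqrt 5 * sqrt 5) / 4) by field.
  rewrite H; field.
Qed.

(** Both [beta] and [1 - beta] are roots of x^2 = x + 1. The recurrence has order two, so the
    induction carries two consecutive indices. *)
Lemma lucas_binet (n : nat) : INR (lucas n) = beta ^ n + (1 - beta) ^ n.
Proof.
  assert (H : INR (lucas n) = beta ^ n + (1 - beta) ^ n
              /\ INR (lucas (S n)) = beta ^ S n + (1 - beta) ^ S n).
  { induction n as [|n [IH1 IH2]]; [split; simpl; ring|].
    split; [exact IH2|].
    change (lucas (S (S n))) with (lucas (S n) + lucas n)%nat.
    rewrite plus_INR, IH1, IH2.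
    replace (beta ^ S (S n)) with (beta ^ 2 * beta ^ n) by (simpl; ring).
    replace ((1 - beta) ^ S (S n)) with ((1 - 2 * beta + beta ^ 2) * (1 - beta) ^ n)
      by (simpl; ring).
    rewrite beta_sq; simpl; ring. }
  exact (proj1 H).
Qed.

(** The roots have product -1, and an even exponent removes the sign. *)
Lemma lucas_even (r : nat) : Nat.Even r -> INR (lucas r) = beta ^ r + / beta ^ r.
Proof.
  intros [m ->]. rewrite lucas_binet.
  assert (beta <> 0) by (pose proof beta_bounds; lra).
  replace (1 - beta) with (-1 * / beta).
  - rewrite Rpow_mult_distr, pow_1_even, pow_inv; ring.
  - apply Rmult_eq_reg_l with beta; [|assumption].
    field_simplify; [|assumption]. rewrite beta_sq; ring.
Qed.

Lemma beta_pow_even_bounds (r : nat) : (0 < r)%nat -> Nat.Even r -> 0 < beta ^ r < 1.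
Proof.
  intros hr [m ->]. rewrite pow_mult. pose proof beta_bounds.
  assert (0 < beta ^ 2 < 1) by nra.
  split; [apply pow_lt; lra|].
  apply pow_lt_1_compat; [lra | lia].
Qed.

(** The case q = s^2 of the kernel integral; the factor 1/s turns s^(2k+1) into q^k. *)
Lemma is_RInt_sq_mul_cos_Li2 (s : R) : 0 < s < 1 ->
  is_RInt (fun x => x ^ 2 * cos x / (1 - 2 * s ^ 2 * cos (2 * x) + (s ^ 2) ^ 2)) 0 PI
    (- (PI / (s * (1 - s ^ 2))) * (Li2 s - Li2 (- s))).
Proof.
  intros Hs.
  assert (Hq : Rabs (s ^ 2) < 1) by (rewrite Rabs_right; nra).
  pose proof (is_RInt_sq_mul_cos_div_poisson _ Hq) as H.
  pose proof (Li2_sub_opp s ltac:(rewrite Rabs_right; lra)) as HL.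
  apply (is_series_scal (/ s)) in HL.
  change (is_series (fun k => / s * (s ^ (2 * k + 1) / (2 * INR k + 1) ^ 2))
            (/ s * ((Li2 s - Li2 (- s)) / 2))) in HL.
  rewrite (Series_ext _ (fun k => / s * (s ^ (2 * k + 1) / (2 * INR k + 1) ^ 2))) in H.
  2:{ intros k.
      rewrite pow_add, pow_mult. field. pose proof (pos_INR k); lra. }
  rewrite (is_series_unique _ _ HL) in H.
  match type of H with is_RInt _ _ _ ?v => match goal with |- is_RInt _ _ _ ?w =>
    replace w with v; [exact H|] end end.
  field. nra.
Qed.

(** The case q = -s^2, with the alternating series evaluated at t = arctan s, which lies below pi/4
    because s < 1. *)
Lemma is_RInt_sq_mul_cos_Cl2 (s : R) : 0 < s < 1 ->
  is_RInt (fun x => x ^ 2 * cos x / (1 + 2 * s ^ 2 * cos (2 * x) + (s ^ 2) ^ 2)) 0 PI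
    (- (PI / (s * (1 + s ^ 2)))
       * (Cl2 (2 * atan s) + Cl2 (PI - 2 * atan s) + 2 * atan s * ln s)).
Proof.
  intros Hs.
  assert (Hq : Rabs (- s ^ 2) < 1) by (rewrite Rabs_Ropp, Rabs_right; nra).
  pose proof (is_RInt_sq_mul_cos_div_poisson _ Hq) as H.
  assert (Ht : 0 < atan s < PI / 4).
  { rewrite <- atan_0, <- atan_1; split; apply atan_increasing; lra. }
  pose proof (inverse_tangent_integral_Cl2 _ Ht) as HL.
  rewrite tan_atan in HL.
  apply (is_series_scal (/ s)) in HL.
  change (is_series (fun k => / s * ((-1) ^ k * s ^ S (2 * k) / (2 * INR k + 1) ^ 2))
            (/ s * ((Cl2 (2 * atan s) + Cl2 (PI - 2 * atan s)) / 2 + atan s * ln s))) in HL.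
  rewrite (Series_ext _
    (fun k => / s * ((-1) ^ k * s ^ S (2 * k) / (2 * INR k + 1) ^ 2))) in H.
  2:{ intros k.
      replace (s ^ S (2 * k)) with (s * (s ^ 2) ^ k) by (rewrite <- pow_mult; reflexivity).
      replace (- s ^ 2) with (-1 * s ^ 2) by ring.
      rewrite Rpow_mult_distr.
      field. pose proof (pos_INR k); lra. }
  rewrite (is_series_unique _ _ HL) in H.
  match type of H with is_RInt _ _ _ ?v => match goal with |- is_RInt _ _ _ ?w =>
    replace w with v end end.
  - apply is_RInt_ext with (2 := H); intros x _; f_equal; ring.
  - field. nra.
Qed.

Theorem theorem51 (r : nat) (hr : (0 < r)%nat) (hr2 : Nat.Even r) :
  is_RInt
    (fun x => x ^ 2 * cos x / (INR (lucas r) ^ 2 - 4 * cos (2 * x) ^ 2)) 0 PI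
    (- (PI / (2 * INR (lucas r))) * (sqrt (beta ^ r) / (1 - beta ^ r))
         * (Li2 (sqrt (beta ^ r)) - Li2 (- sqrt (beta ^ r)))
     - PI / (2 * INR (lucas r)) * (sqrt (beta ^ r) / (1 + beta ^ r))
         * (Cl2 (2 * atan (sqrt (beta ^ r)))
            + Cl2 (PI - 2 * atan (sqrt (beta ^ r))))
     - PI / INR (lucas r) * (sqrt (beta ^ r) / (1 + beta ^ r))
         * atan (sqrt (beta ^ r)) * ln (sqrt (beta ^ r)))
  /\
  is_RInt
    (fun x => x ^ 2 * cos (3 * x) / (INR (lucas r) ^ 2 - 4 * cos (2 * x) ^ 2))
    0 PI
    ((1 / INR (lucas r) - 1) * (PI / 2) * (sqrt (beta ^ r) / (1 - beta ^ r))
         * (Li2 (sqrt (beta ^ r)) - Li2 (- sqrt (beta ^ r)))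
     + (1 / INR (lucas r) + 1) * (PI / 2) * (sqrt (beta ^ r) / (1 + beta ^ r))
         * (Cl2 (2 * atan (sqrt (beta ^ r)))
            + Cl2 (PI - 2 * atan (sqrt (beta ^ r))))
     + (1 / INR (lucas r) + 1) * (PI * sqrt (beta ^ r) / (1 + beta ^ r))
         * atan (sqrt (beta ^ r)) * ln (sqrt (beta ^ r))).
Proof.
  pose proof (beta_pow_even_bounds r hr hr2) as Hp.
  rewrite (lucas_even r hr2).
  set (s := sqrt (beta ^ r)).
  assert (Es : beta ^ r = s ^ 2) by (symmetry; apply pow2_sqrt; lra).
  assert (Hs : 0 < s < 1).
  { split; [apply sqrt_lt_R0; lra|].
    rewrite <- sqrt_1; apply sqrt_lt_1; lra. }
  rewrite Es in *; clearbody s; clear Es.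
  set (L := s ^ 2 + / s ^ 2).
  assert (HL : L <> 0) by (unfold L; pose proof (Rinv_0_lt_compat _ (proj1 Hp)); lra).
  pose proof (is_RInt_sq_mul_cos_Li2 s Hs) as H1.
  pose proof (is_RInt_sq_mul_cos_Cl2 s Hs) as H2.
  assert (HD : forall x, 0 < 1 - 2 * s ^ 2 * cos (2 * x) + (s ^ 2) ^ 2
                      /\ 0 < 1 + 2 * s ^ 2 * cos (2 * x) + (s ^ 2) ^ 2).
  { intros x. pose proof (COS_bound (2 * x)). nra. }
  (* Difference of squares: s^2 (L - 2 cos 2x) and s^2 (L + 2 cos 2x) are the two kernel
     denominators, as s^2 L = 1 + s^4. *)
  assert (HDL : forall x, L ^ 2 - 4 * cos (2 * x) ^ 2
    = (1 - 2 * s ^ 2 * cos (2 * x) + (s ^ 2) ^ 2)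
      * (1 + 2 * s ^ 2 * cos (2 * x) + (s ^ 2) ^ 2) / (s ^ 2) ^ 2).
  { intros x; unfold L; field; lra. }
  assert (H3 : forall A B, is_RInt
     (fun x => A * (x ^ 2 * cos x / (1 - 2 * s ^ 2 * cos (2 * x) + (s ^ 2) ^ 2))
             + B * (x ^ 2 * cos x / (1 + 2 * s ^ 2 * cos (2 * x) + (s ^ 2) ^ 2))) 0 PI
     (A * (- (PI / (s * (1 - s ^ 2))) * (Li2 s - Li2 (- s)))
      + B * (- (PI / (s * (1 + s ^ 2)))
       * (Cl2 (2 * atan s) + Cl2 (PI - 2 * atan s) + 2 * atan s * ln s)))).
  { intros A B.
    exact (is_RInt_plus _ _ _ _ _ _ (is_RInt_scal _ _ _ A _ H1) (is_RInt_scal _ _ _ B _ H2)). }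
  assert (Hs2 : 1 - s ^ 2 <> 0) by lra.
  assert (Hs3 : 1 + s ^ 2 <> 0) by lra.
  assert (Hs4 : 1 + (s ^ 2) ^ 2 <> 0) by nra.
  split.
  (* With c = cos 2x, 1/(L^2 - 4c^2) = (1/(L - 2c) + 1/(L + 2c))/(2L), and 1/(L - 2c), 1/(L + 2c)
     are s^2 over the kernel denominators; hence two equal coefficients. *)
  - match goal with |- is_RInt _ _ _ ?v =>
      replace v with (s ^ 2 / (2 * L) * (- (PI / (s * (1 - s ^ 2))) * (Li2 s - Li2 (- s)))
      + s ^ 2 / (2 * L) * (- (PI / (s * (1 + s ^ 2)))
       * (Cl2 (2 * atan s) + Cl2 (PI - 2 * atan s) + 2 * atan s * ln s)))
      by (field; repeat split; lra) end.
    apply is_RInt_ext with (2 := H3 _ _); intros x _.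
    destruct (HD x). rewrite HDL. unfold L. match goal with |- ?a = ?b => change (@eq R a b) end. field.
    repeat split; lra.
  (* Here cos 3x = (2c - 1) cos x with c = cos 2x. The numerator 2c - 1 equals L - 1 at 2c = L and
     -(L + 1) at 2c = -L, which gives the two coefficients. *)
  - match goal with |- is_RInt _ _ _ ?v =>
      replace v with
       ((L - 1) / (2 * L) * s ^ 2 * (- (PI / (s * (1 - s ^ 2))) * (Li2 s - Li2 (- s)))
      + - ((L + 1) / (2 * L)) * s ^ 2 * (- (PI / (s * (1 + s ^ 2)))
       * (Cl2 (2 * atan s) + Cl2 (PI - 2 * atan s) + 2 * atan s * ln s)))
      by (field; repeat split; lra) end.
    apply is_RInt_ext with (2 := H3 _ _); intros x _.
    destruct (HD x). rewrite HDL. unfold L. match goal with |- ?a = ?b => change (@eq R a b) end.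
    replace (cos (3 * x)) with (cos x * (2 * cos (2 * x) - 1)).
    + field. repeat split; lra.
    + replace (3 * x) with (2 * x + x) by ring.
      rewrite cos_plus, sin_2a, cos_2a_cos.
      replace (2 * sin x * cos x * sin x) with (2 * (sin x)² * cos x) by (unfold Rsqr; ring).
      rewrite sin2; unfold Rsqr; ring.
Qed.
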